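(* Consider input-output data $(U,Y)$ with data matrices $Y_-\in\mathbb{R}^{p\times N}$, $U_-\in\mathbb{R}^{m\times N}$, $Z_-\in\mathbb{R}^{n\times N}$, instrumental data $R_-\in\mathbb{R}^{M\times N}$ and noise-bound matrices $Q_{11},Q_{12},Q_{22}$ with $Q_{22}\prec 0$, as in the context. The data $(U,Y)$ are informative for quadratic stabilization by an output-feedback controller $C(q^{-1})u(t)=D(q^{-1})y(t)$ if there exist $L\in\mathbb{R}^{m\times n}$, $P\in\mathbb{R}^{n\times n}$ with $P\succ 0$, $\alpha\geq 0$ and $\beta>0$ such that $$\begin{bmatrix} P-\beta I & -J_1P-J_2L & 0 & J_1P+J_2L\\ -PJ_1^\top-L^\top J_2^\top & -P & -L^\top & 0\\ 0& -L & 0 & L\\ PJ_1^\top+L^\top J_2^\top & 0 & L^\top & P \end{bmatrix}-\alpha \begin{bmatrix} I & H_zY_-R_-^\top\\ 0 & -Z_-R_-^\top\\ 0 & -U_-R_-^\top\\ 0 & 0 \end{bmatrix}Q_e\begin{bmatrix} I & H_zY_-R_-^\top\\ 0 & -Z_-R_-^\top\\ 0 & -U_-R_-^\top\\ 0 & 0 \end{bmatrix}^\top\succeq 0 .\qquad ( * )$$ Moreover, for any $L$ and $P\succ0$ such that $( * )$ is satisfied (for some $\alpha\ge 0$, $\beta>0$), the matrix $A_z+B_zK$ with $K:=LP^{-1}$ is stable (all its eigenvalues lie in the open unit disk) for all $(A_z,B_z)\in\bar{\Sigma}^{RQ}_{(U,Y)}$.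
   Context: All matrices are real; $\succ,\succeq,\prec$ refer to symmetric matrices in the (semi)definite order. Zero and identity blocks have the dimensions dictated by conformity. System and data. Fix integers $p,m,l,N,M\ge1$ and let $n:=(p+m)l$. The system class is $A(q^{-1})y(t)=B(q^{-1})u(t)+e(t)$, $y(t)\in\mathbb{R}^p$, $u(t)\in\mathbb{R}^m$, noise $e(t)\in\mathbb{R}^p$, $q^{-1}$ the delay operator, $A(\xi)=I+A_1\xi+\cdots+A_l\xi^l$, $B(\xi)=B_0+B_1\xi+\cdots+B_l\xi^l$. Put $\bar A:=[-A_1\ \cdots\ -A_l]\in\mathbb{R}^{p\times pl}$, $\bar B:=[B_1\ \cdots\ B_l]\in\mathbb{R}^{p\times ml}$, and $\zeta(t):=\operatorname{col}(y(t-1),\dots,y(t-l),u(t-1),\dots,u(t-l))\in\mathbb{R}^n$. Data matrices: $Z_-=[\zeta(0)\cdots\zeta(N-1)]$, $Y_-=[y(0)\cdots y(N-1)]$, $U_-=[u(0)\cdots u(N-1)]$; the noise matrix $E_-=[e(0)\cdots e(N-1)]$ is unknown. The data equation is $$Y_-=[\bar A\ \ \bar B]Z_-+B_0U_-+E_-.\quad\text{(D)}$$ Noise bound. A given signal $r(t)\in\mathbb{R}^M$ defines $R_-=[r(0)\cdots r(N-1)]$. With a given symmetric matrix $Q=\begin{bmatrix} Q_{11} & Q_{12} \\ Q_{12}^\top & Q_{22} \end{bmatrix}$, $Q_{11}\in\mathbb{R}^{p\times p}$, $Q_{22}\in\mathbb{R}^{M\times M}$, $Q_{22}\prec0$, the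 noise is known to satisfy $$\begin{bmatrix} I \\ R_-E_-^\top \end{bmatrix}^\top Q\begin{bmatrix} I \\ R_-E_-^\top \end{bmatrix}\succeq0.\quad\text{(N)}$$ State-space matrices. Partition the $n$ rows into blocks of sizes $p,\ p(l-1),\ m,\ m(l-1)$. Let $H_z=\operatorname{col}(I_p,0,0,0)\in\mathbb{R}^{n\times p}$, $J_2=\operatorname{col}(0,0,I_m,0)\in\mathbb{R}^{n\times m}$, and let $J_1\in\mathbb{R}^{n\times n}$, with column blocks of sizes $p(l-1),p,m(l-1),m$, be $$J_1=\begin{bmatrix} 0 & 0 & 0 & 0 \\ I_{p(l-1)} & 0 & 0 & 0 \\ 0 & 0 & 0 & 0 \\ 0 & 0 & I_{m(l-1)} & 0 \end{bmatrix}.$$ Let $Q_e:=\begin{bmatrix} H_zQ_{11}H_z^\top & H_zQ_{12} \\ Q_{12}^\top H_z^\top & Q_{22} \end{bmatrix}$. Compatible systems. $\Sigma^{RQ}_{(U,Y)}$ is the set of all pairs $(\Lambda_e,B_e)=\left(\begin{bmatrix} \bar A & \bar B \\ 0 & 0 \end{bmatrix},\begin{bmatrix} B_0 \\ 0 \end{bmatrix}\right)\in\mathbb{R}^{n\times n}\times\mathbb{R}^{n\times m}$ (with $\bar A\in\mathbb{R}^{p\times pl}$, $\bar B\in\mathbb{R}^{p\times ml}$, $B_0\in\mathbb{R}^{p\times m}$) for which there exists $E_-\in\mathbb{R}^{p\times N}$ such that (D) and (N) hold. Further $\bar\Sigma^{RQ}_{(U,Y)}:=\{(\Lambda_e+J_1,B_e+J_2)\mid(\Lambda_e,B_e)\in\Sigma^{RQ}_{(U,Y)}\}$;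 its elements are denoted $(A_z,B_z)$, and $\zeta(t+1)=A_z\zeta(t)+B_zu(t)+H_ze(t)$. Controller. The output-feedback controller is $C(q^{-1})u(t)=D(q^{-1})y(t)$ with $C(\xi)=I+C_1\xi+\cdots+C_l\xi^l$ and $D(\xi)=D_1\xi+\cdots+D_l\xi^l$; equivalently $u(t)=K\zeta(t)$ with $K=[D_1\cdots D_l\ \ -C_1\cdots-C_l]\in\mathbb{R}^{m\times n}$, so that the closed-loop state matrix is $A_z+B_zK$. Informativity. The data $(U,Y)$ are informative for quadratic stabilization by an output-feedback controller if there exist $K\in\mathbb{R}^{m\times n}$ and $P\succ0$ such that $\bar\Sigma^{RQ}_{(U,Y)}\subseteq\{(A,B)\mid(A+BK)P(A+BK)^\top-P\prec0\}$. *)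

(* Defs.v *)
From mathcomp Require Import all_boot all_order all_algebra.
From mathcomp Require Import all_classical all_reals.
From mathcomp Require Import complex.

Set Implicit Arguments.
Unset Strict Implicit.
Unset Printing Implicit Defensive.

Import Order.TTheory GRing.Theory Num.Theory.
Local Open Scope classical_set_scope.
Local Open Scope ring_scope.

Section MatrixOrder.
Variables (R : realType) (k : nat).
Implicit Type A : 'M[R]_k.

Definition possemidef A : Prop :=
  A^T = A /\ forall x : 'cV[R]_k, 0 <= (x^T *m A *m x) 0 0.

Definition posdef A : Prop :=
  A^T = A /\ forall x : 'cV[R]_k, x != 0 -> 0 < (x^T *m A *m x) 0 0.

Definition negdef A : Prop := posdef (- A).

(* The spectrum of a real matrix is taken in the complex numbers R[i]. *)
Definition stable A : Prop :=
  forall z : R[i], eigenvalue (map_mx (real_complex R) A) z -> `|z| < 1.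

End MatrixOrder.

(* Dimension of l stacked blocks of size k, for l >= 1, split as the first
   block and the l - 1 others. *)
Definition stkdim (k l : nat) : nat := (k + l.-1 * k)%N.

(* n = (p + m) l. *)
Definition zdim (p m l : nat) : nat := (stkdim p l + stkdim m l)%N.

Lemma stkdimE k l : (0 < l)%N -> stkdim k l = (k * l)%N.
Proof. by case: l => // l _; rewrite /stkdim /= mulnS mulnC. Qed.

Lemma zdimE p m l : (0 < l)%N -> zdim p m l = ((p + m) * l)%N.
Proof. by move=> l0; rewrite /zdim !stkdimE // mulnDl. Qed.

Section Data.
Variables (R : realType).

(* past v j t = col(v(t-1), ..., v(t-j)); the dimensions agree because
   j.+1 * k is convertible to k + j * k. *)
Fixpoint past k (v : int -> 'cV[R]_k) (j : nat) (t : int) : 'cV[R]_(j * k) :=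
  match j with
  | 0%N => 0
  | j'.+1 => col_mx (v (t - 1)) (past v j' (t - 1))
  end.

Definition stack k (v : int -> 'cV[R]_k) (l : nat) (t : int) :
    'cV[R]_(stkdim k l) :=
  col_mx (v (t - 1)) (past v l.-1 (t - 1)).

Definition zeta p m l (y : int -> 'cV[R]_p) (u : int -> 'cV[R]_m) (t : int) :
    'cV[R]_(zdim p m l) :=
  col_mx (stack y l t) (stack u l t).

Definition data_mx k (N : nat) (v : int -> 'cV[R]_k) : 'M[R]_(k, N) :=
  \matrix_(i < k, j < N) v j%:Z i 0.

End Data.

Section System.
Variables (R : realType) (p m l : nat).
Local Notation n := (zdim p m l).

Definition H_z : 'M[R]_(n, p) := col_mx (col_mx 1%:M 0) (0 : 'M_(stkdim m l, p)).

Definition J_2 : 'M[R]_(n, m) := col_mx (0 : 'M_(stkdim p l, m)) (col_mx 1%:M 0).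

(* The block [0 0; I 0] with row blocks of sizes k, k(l-1) and column blocks of
   sizes k(l-1), k; the cast only makes the matrix syntactically square. *)
Definition shift_mx (k : nat) : 'M[R]_(stkdim k l) :=
  castmx (erefl, addnC (l.-1 * k)%N k)
    (block_mx (0 : 'M_(k, (l.-1 * k)%N)) (0 : 'M_(k, k))
              1%:M (0 : 'M_((l.-1 * k)%N, k))).

Definition J_1 : 'M[R]_n := block_mx (shift_mx p) 0 0 (shift_mx m).

Definition Lambda_e (Abar : 'M[R]_(p, stkdim p l))
    (Bbar : 'M[R]_(p, stkdim m l)) : 'M[R]_n :=
  col_mx (col_mx (row_mx Abar Bbar) 0) (0 : 'M_(stkdim m l, n)).

Definition B_e (B0 : 'M[R]_(p, m)) : 'M[R]_(n, m) :=
  col_mx (col_mx B0 0) (0 : 'M_(stkdim m l, m)).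

Section Noise.
Variables (M : nat) (Q11 : 'M[R]_p) (Q12 : 'M[R]_(p, M)) (Q22 : 'M[R]_M).

Definition Q_e : 'M[R]_(n + M) :=
  block_mx (H_z *m Q11 *m H_z^T) (H_z *m Q12) (Q12^T *m H_z^T) Q22.

Definition noise_bound N (Rm : 'M[R]_(M, N)) (Em : 'M[R]_(p, N)) : Prop :=
  let V := col_mx 1%:M (Rm *m Em^T) : 'M[R]_(p + M, p) in
  possemidef (V^T *m block_mx Q11 Q12 Q12^T Q22 *m V).

Variables (N : nat) (y : int -> 'cV[R]_p) (u : int -> 'cV[R]_m)
  (r : int -> 'cV[R]_M).
Local Notation Ym := (data_mx N y).
Local Notation Um := (data_mx N u).
Local Notation Zm := (data_mx N (zeta l y u)).
Local Notation Rm := (data_mx N r).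

Definition Sigma : set ('M[R]_n * 'M[R]_(n, m)) :=
  [set LB | exists (Abar : 'M[R]_(p, stkdim p l)) (Bbar : 'M[R]_(p, stkdim m l))
                   (B0 : 'M[R]_(p, m)) (Em : 'M[R]_(p, N)),
    [/\ LB = (Lambda_e Abar Bbar, B_e B0),
        Ym = row_mx Abar Bbar *m Zm + B0 *m Um + Em
      & noise_bound Rm Em]].

Definition Sigma_bar : set ('M[R]_n * 'M[R]_(n, m)) :=
  [set (LB.1 + J_1, LB.2 + J_2) | LB in Sigma].

(* A gain K = [D_1 ... D_l  -C_1 ... -C_l] is the controller
   C(q^-1) u(t) = D(q^-1) y(t), that is u(t) = K zeta(t). *)
Definition informative_quad_stab : Prop :=
  exists (K : 'M[R]_(m, n)) (P : 'M[R]_n), posdef P /\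
    Sigma_bar `<=`
      [set AB | negdef ((AB.1 + AB.2 *m K) *m P *m (AB.1 + AB.2 *m K)^T - P)].

Definition lmi_base (L : 'M[R]_(m, n)) (P : 'M[R]_n) (beta : R) :
    'M[R]_(n + (n + (m + n))) :=
  let T := J_1 *m P + J_2 *m L in
  col_mx (row_mx (P - beta%:M) (row_mx (- T)   (row_mx 0      T  )))
 (col_mx (row_mx (- T^T)       (row_mx (- P)   (row_mx (-L^T) 0  )))
 (col_mx (row_mx 0             (row_mx (- L)   (row_mx 0      L  )))
         (row_mx T^T           (row_mx 0       (row_mx L^T    P  ))))).

Definition lmi_data : 'M[R]_(n + (n + (m + n)), n + M) :=
  col_mx (row_mx 1%:M (H_z *m Ym *m Rm^T))
 (col_mx (row_mx 0    (- Zm *m Rm^T))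
 (col_mx (row_mx 0    (- Um *m Rm^T))
         (row_mx 0    0))).

Definition lmi (L : 'M[R]_(m, n)) (P : 'M[R]_n) (alpha beta : R) : Prop :=
  possemidef (lmi_base L P beta - alpha *: (lmi_data *m Q_e *m lmi_data^T)).

End Noise.
End System.

Arguments H_z {R} p m l.
Arguments J_1 {R} p m l.
Arguments J_2 {R} p m l.
Arguments Sigma {R p m} l {M} Q11 Q12 Q22 N y u r.
Arguments Sigma_bar {R p m} l {M} Q11 Q12 Q22 N y u r.
Arguments informative_quad_stab {R p m} l {M} Q11 Q12 Q22 N y u r.
Arguments lmi {R p m} l {M} Q11 Q12 Q22 N y u r L P alpha beta.

(* Main.v *)
(* Put G = J_1 + J_2 K with L = K P, and let C = A_z + B_z K be the closed loop
   matrix.  Multiplying the LMI on the left by [I  Lambda_e  B_e  -(G + B_e K)]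
   and on the right by its transpose turns the model part into
   P - beta I - C P C^T and, by the data equation, the data part into alpha
   times the noise form conjugated by H_z, which is positive semidefinite.
   Hence C P C^T - P < 0, a Lyapunov inequality for C. *)
Require Import Defs.
From mathcomp Require Import all_boot all_order all_algebra.
From mathcomp Require Import all_classical all_reals.
From mathcomp Require Import complex.
From mathcomp Require Import ring lra.

Import Order.TTheory GRing.Theory Num.Theory.
Local Open Scope classical_set_scope.
Local Open Scope ring_scope.

Lemma dotmx_gt0 (R : realType) k (x : 'cV[R]_k) : x != 0 -> 0 < (x^T *m x) 0 0.
Proof.
move=> x0; rewrite mxE lt_def sumr_ge0 ?andbT; last first.
  by move=> i _; rewrite mxE -expr2 sqr_ge0.
apply: contraNneq x0 => /eqP; rewrite psumr_eq0; last first.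
  by move=> i _; rewrite mxE -expr2 sqr_ge0.
move=> /allP x0; apply/eqP/matrixP => i j; rewrite ord1 [RHS]mxE.
by have := x0 i (mem_index_enum i); rewrite mxE mulf_eq0 orbb => /eqP.
Qed.

Lemma possemidef_congr (R : realType) k h (A : 'M[R]_k) (V : 'M[R]_(h, k)) :
  possemidef A -> possemidef (V *m A *m V^T).
Proof.
move=> [As Ap]; split; first by rewrite !trmx_mul trmxK As mulmxA.
by move=> x; have := Ap (V^T *m x); rewrite trmx_mul trmxK !mulmxA.
Qed.

(** A nonzero row of the left kernel of [P] would make the quadratic form vanish. *)
Lemma posdef_unitmx (R : realType) k (P : 'M[R]_k) : posdef P -> P \in unitmx.
Proof.
move=> [_ Pp]; rewrite -row_free_unit -kermx_eq0; apply/negPn/negP => k0.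
have [i ri] : exists i, row i (kermx P) != 0.
  by apply/existsP; apply: contraR k0 => /existsPn H;
    apply/eqP/row_matrixP => i; rewrite row0; apply/eqP/negPn/H.
have := Pp (row i (kermx P))^T; rewrite trmx_eq0 => /(_ ri).
by rewrite trmxK -row_mul mulmx_ker row0 mul0mx mxE ltxx.
Qed.

(** Strictness comes from the multiple of the identity: [b] times the squared norm of [x] is
    positive, while the other contributions are only nonnegative. *)
Lemma posdef_possemidef_sub (R : realType) k (A B : 'M[R]_k) (a b : R) :
  0 <= a -> 0 < b -> possemidef B -> possemidef (A - b%:M - a *: B) -> posdef A.
Proof.
move=> a0 b0 [Bs Bp] [Ds Dp]; split=> [|x x0].
  have -> : A = (A - b%:M - a *: B) + a *: B + b%:M by rewrite !subrK.
  by rewrite raddfD raddfD /= Ds tr_scalar_mx [(a *: B)^T]linearZ /= Bs.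
have := Dp x; rewrite !(mulmxBr, mulmxBl) -scalemxAr -scalemxAl.
rewrite mul_mx_scalar -scalemxAl !mxE.
have := mulr_ge0 a0 (Bp x); have := mulr_gt0 b0 (dotmx_gt0 _ _ _ x0).
rewrite !mxE; lra.
Qed.

(** The argument stays over the reals. Write a left eigenvector as [a + i b] and its eigenvalue [z]
    as [s + i t]. With [q] the quadratic form of [P], the sum [q a + q b] is multiplied by [|z|^2]
    under [C], and the Lyapunov inequality forces it to decrease. *)
Lemma lyapunov_stable (R : realType) k (C P : 'M[R]_k) :
  posdef P -> negdef (C *m P *m C^T - P) -> stable C.
Proof.
move=> [Ps Pp] [_ Np] z /eigenvalueP [v vC v0].
pose q (w : 'rV[R]_k) := (w *m P *m w^T) 0 0.
have q_gt0 w : w != 0 -> 0 < q w.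
  by move=> w0; have := Pp w^T; rewrite trmx_eq0 trmxK; apply.
have q_lt w : w != 0 -> q (w *m C) < q w.
  move=> w0; have := Np w^T; rewrite trmx_eq0 trmxK => /(_ w0).
  rewrite opprB mulmxBr mulmxBl [X in 0 < X]mxE [X in _ + X]mxE subr_gt0.
  by rewrite /q trmx_mul !mulmxA.
have q_0 : q 0 = 0 by rewrite /q !mul0mx mxE.
(* The cross terms between [a] and [b] carry the factors [- s t] and [t s], so they cancel. *)
have q_rot (s t : R) a b :
    q (s *: a - t *: b) + q (t *: a + s *: b) = (s ^+ 2 + t ^+ 2) * (q a + q b).
  have trZ c (w : 'rV[R]_k) : (c *: w)^T = c *: w^T by rewrite linearZ.
  have addE (v1 v2 : 'M[R]_1) : (v1 + v2) 0 0 = v1 0 0 + v2 0 0 by rewrite mxE.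
  have oppE (v1 : 'M[R]_1) : (- v1) 0 0 = - v1 0 0 by rewrite mxE.
  have sclE c (v1 : 'M[R]_1) : (c *: v1) 0 0 = c * v1 0 0 by rewrite mxE.
  rewrite /q raddfB [(_ + _)^T]raddfD /= !trZ !(mulmxDl, mulmxDr, mulmxN, mulNmx).
  rewrite -!(scalemxAr, scalemxAl) !(addE, oppE, sclE).
  ring.
case: z vC => s t vC.
pose a := map_mx (@complex.Re R) v; pose b := map_mx (@complex.Im R) v.
have vE i j : v i j = (a i j +i* b i j)%C by rewrite !mxE; case: (v i j).
have vCE j : (v *m map_mx (real_complex R) C) 0 j
    = ((a *m C) 0 j +i* (b *m C) 0 j)%C.
  rewrite !mxE; apply/eqP; rewrite eq_complex /= !raddf_sum /=.
  by apply/andP; split; apply/eqP/eq_bigr => i _; rewrite vE !mxE /=; ring.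
have vz j : (v *m map_mx (real_complex R) C) 0 j
   = ((s * a 0 j - t * b 0 j) +i* (t * a 0 j + s * b 0 j))%C.
  by rewrite vC mxE vE; apply/eqP; rewrite eq_complex /=; apply/andP; split;
    apply/eqP; ring.
have aC : a *m C = s *: a - t *: b.
  apply/rowP => j; have := vz j; rewrite vCE => -[-> _].
  by rewrite !mxE.
have bC : b *m C = t *: a + s *: b.
  apply/rowP => j; have := vz j; rewrite vCE => -[_ ->].
  by rewrite !mxE.
have ab0 : (a != 0) || (b != 0).
  rewrite -negb_and; apply: contra v0 => /andP[/eqP a0 /eqP b0].
  by apply/eqP/rowP => j; rewrite vE a0 b0 !mxE.
(* One of [a] and [b] may be zero, so weak inequalities are needed for that one; the other supplies
   strictness. *)
have q_ge0 w : 0 <= q w.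
  by have [->|/q_gt0/ltW //] := eqVneq w 0; rewrite q_0.
have q_le w : q (w *m C) <= q w.
  by have [->|/q_lt/ltW //] := eqVneq w 0; rewrite mul0mx.
have qab : 0 < q a + q b.
  by case/orP: ab0 => /q_gt0 H; [apply: ltr_wpDr | apply: ltr_wpDl].
have : q (a *m C) + q (b *m C) < q a + q b.
  by case/orP: ab0 => /q_lt H; [apply: ltr_leD | apply: ler_ltD].
rewrite aC bC q_rot -[ltRHS]mul1r ltr_pM2r // => st1.
(* The modulus is a real square root embedded in [R[i]]; reading 1 as the embedded root of 1 reduces
   the claim to [st1]. *)
rewrite normc_def /= -[1]/((1 : R)%:C)%C ltcR -[ltRHS]sqrtr1 ltr_sqrt //.
Qed.

Section LMI.
Variables (R : realType) (p m l : nat).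
Local Notation n := (zdim p m l).

Lemma Lambda_eE (Abar : 'M[R]_(p, stkdim p l)) (Bbar : 'M[R]_(p, stkdim m l)) :
  Lambda_e Abar Bbar = H_z p m l *m row_mx Abar Bbar.
Proof. by rewrite /H_z !mul_col_mx !mul0mx mul1mx. Qed.

Lemma B_eE (B0 : 'M[R]_(p, m)) : B_e l B0 = H_z p m l *m B0.
Proof. by rewrite /H_z !mul_col_mx !mul0mx mul1mx. Qed.

(** The last block of [V] is chosen to cancel the last block column: with [G = J_1 + J_2 K], that
    column gives [G P + B K P - (G + B K) P = 0]. *)
Lemma lmi_base_congr (Lam : 'M[R]_n) (B : 'M[R]_(n, m)) (K : 'M[R]_(m, n))
    (P : 'M[R]_n) (beta : R) :
  let C := Lam + J_1 p m l + (B + J_2 p m l) *m K in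
  let V := row_mx 1%:M
    (row_mx Lam (row_mx B (- (J_1 p m l + J_2 p m l *m K + B *m K)))) in
  P^T = P ->
  V *m lmi_base (K *m P) P beta *m V^T = P - beta%:M - C *m P *m C^T.
Proof.
move=> C V Ps.
pose G : 'M[R]_n := J_1 p m l + J_2 p m l *m K.
have CE : C = Lam + B *m K + G by rewrite /C /G mulmxDl -!addrA; congr (_ + _); rewrite addrCA.
have TE : J_1 p m l *m P + J_2 p m l *m (K *m P) = G *m P.
  by rewrite mulmxA -mulmxDl.
rewrite /V -/G /lmi_base TE !trmx_mul Ps; clearbody G.
(* After left multiplication every remaining block contains [C P]. Multiplying by [V^T] then
   collects [G^T], [Lam^T] and [K^T B^T] into [C^T]. *)
have -> : row_mx 1%:M (row_mx Lam (row_mx B (- (G + B *m K)))) *m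
 col_mx (row_mx (P - beta%:M) (row_mx (- (G *m P)) (row_mx 0 (G *m P))))
 (col_mx (row_mx (- (P *m G^T)) (row_mx (- P) (row_mx (- (P *m K^T)) 0)))
 (col_mx (row_mx 0 (row_mx (- (K *m P)) (row_mx 0 (K *m P))))
         (row_mx (P *m G^T) (row_mx 0 (row_mx (P *m K^T) P)))))
  = row_mx (P - beta%:M - C *m P *m G^T)
      (row_mx (- (C *m P)) (row_mx (- (C *m P *m K^T)) 0)).
  rewrite !mul_row_col !mul_mx_row !add_row_mx !mul1mx !mulmx0 !add0r !addr0.
  rewrite CE; congr row_mx; [|congr row_mx; [|congr row_mx]].
  - rewrite !(mulmxN, mulNmx, mulmxDl, mulmxA, opprD) -!addrA.
    by do 3 congr (_ + _); rewrite addrC.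
  - rewrite !(mulmxN, mulNmx, mulmxDl, mulmxA, opprD) -!addrA.
    by rewrite [LHS]addrC -addrA.
  - rewrite !(mulmxN, mulNmx, mulmxDl, mulmxA, opprD) -!addrA.
    by congr (_ + _); rewrite addrC.
  - by rewrite addrA mulNmx mulmxDl !mulmxA subrr.
rewrite !tr_row_mx !mul_row_col trmx1 mulmx1 mul0mx addr0.
have -> : C^T = Lam^T + K^T *m B^T + G^T by rewrite CE !raddfD /= trmx_mul.
rewrite !mulmxDr !mulNmx !mulmxA !opprD -!addrA.
by do 2 congr (_ + _); rewrite [LHS]addrC -addrA.
Qed.

(** The data equation leaves only the noise in [V D], which becomes [[I H E R^T]]. The block [F] is
    arbitrary because it meets the zero block row of [D]. *)
Lemma lmi_data_congr (M N : nat) (Q11 : 'M[R]_p) (Q12 : 'M[R]_(p, M))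
    (Q22 : 'M[R]_M) (y : int -> 'cV[R]_p) (u : int -> 'cV[R]_m)
    (r : int -> 'cV[R]_M) (Abar : 'M[R]_(p, stkdim p l))
    (Bbar : 'M[R]_(p, stkdim m l)) (B0 : 'M[R]_(p, m)) (Em : 'M[R]_(p, N))
    (F : 'M[R]_n) :
  let H := H_z p m l in
  let V := row_mx 1%:M
    (row_mx (Lambda_e Abar Bbar) (row_mx (B_e l B0) F)) in
  let D := lmi_data l N y u r in
  let W := col_mx 1%:M (data_mx N r *m Em^T) : 'M[R]_(p + M, p) in
  data_mx N y = row_mx Abar Bbar *m data_mx N (zeta l y u)
    + B0 *m data_mx N u + Em ->
  V *m (D *m Q_e m l Q11 Q12 Q22 *m D^T) *m V^T
  = H *m (W^T *m block_mx Q11 Q12 Q12^T Q22 *m W) *m H^T.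
Proof.
move=> H V D W dataE.
have VD : V *m D = row_mx 1%:M (H *m Em *m (data_mx N r)^T).
  rewrite /V /D /lmi_data Lambda_eE B_eE !mul_row_col !mul_mx_row !add_row_mx.
  rewrite !mulmx0 !mul1mx !addr0 -/H dataE; congr row_mx.
  rewrite !mulmxDr !mulmxDl !(mulNmx, mulmxN) !mulmxA.
  by rewrite -opprD -mul_mx_row [LHS]addrAC subrr add0r.
(* [Q_e] is the noise matrix conjugated by [diag(H, I)]; absorbing this factor into [V D] lets [H]
   come out on the left, as [H W^T]. *)
have QE : Q_e m l Q11 Q12 Q22
    = block_mx H 0 0 1%:M *m block_mx Q11 Q12 Q12^T Q22 *m (block_mx H 0 0 1%:M)^T.
  rewrite /Q_e tr_block_mx !mulmx_block !trmx0 !trmx1.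
  by rewrite !(mul0mx, mulmx0, mul1mx, mulmx1, addr0, add0r).
have WE : row_mx 1%:M (H *m Em *m (data_mx N r)^T) *m block_mx H 0 0 1%:M = H *m W^T.
  rewrite mul_row_block /W tr_col_mx trmx_mul trmxK trmx1 mul_mx_row.
  by rewrite !(mul0mx, mulmx0, mul1mx, mulmx1, addr0, add0r) mulmxA.
rewrite !mulmxA VD -[_ *m D^T *m V^T]mulmxA -trmx_mul VD QE !mulmxA WE.
by rewrite -[_ *m _^T *m _^T]mulmxA -trmx_mul WE trmx_mul trmxK !mulmxA.
Qed.

(** Common core of both claims: only the multiplier [V] depends on the compatible system, so the
    same gain and the same [P] serve all of them. *)
Lemma lmi_lyapunov (M N : nat) (Q11 : 'M[R]_p) (Q12 : 'M[R]_(p, M))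
    (Q22 : 'M[R]_M) (y : int -> 'cV[R]_p) (u : int -> 'cV[R]_m)
    (r : int -> 'cV[R]_M) (L : 'M[R]_(m, n)) (P : 'M[R]_n) (alpha beta : R)
    (A : 'M[R]_n) (B : 'M[R]_(n, m)) :
  let C := A + B *m (L *m invmx P) in
  posdef P -> 0 <= alpha -> 0 < beta ->
  lmi l Q11 Q12 Q22 N y u r L P alpha beta ->
  Sigma_bar l Q11 Q12 Q22 N y u r (A, B) ->
  negdef (C *m P *m C^T - P).
Proof.
move=> C Pp a0 b0 lmiP [_ [Abar [Bbar [B0 [Em [-> dataE noise]]]]] [EA EB]].
have Ps : P^T = P by case: Pp.
pose K := L *m invmx P.
have LE : L = K *m P by rewrite /K mulmxKV // posdef_unitmx.
pose V := row_mx 1%:M (row_mx (Lambda_e Abar Bbar) (row_mx (B_e l B0)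
  (- (J_1 p m l + J_2 p m l *m K + B_e l B0 *m K)))).
have := possemidef_congr R _ _ _ V lmiP.
rewrite mulmxBr mulmxBl LE lmi_base_congr // -scalemxAr -scalemxAl.
rewrite (lmi_data_congr _ _ _ _ _ _ _ _ _ _ _ _ _ dataE).
set S := H_z p m l *m _ *m _.
rewrite /= in EA EB; rewrite EA EB -/K -/C /negdef opprB.
(* The roles are [A := P - C P C^T], [b := beta], and [B := S], the noise form conjugated by
   [H_z]. *)
rewrite [P - _ - _]addrAC; apply: posdef_possemidef_sub a0 b0 _.
exact: possemidef_congr.
Qed.

End LMI.

Theorem theorem1 (R : realType) (p m l N M : nat)
    (hp : (0 < p)%N) (hm : (0 < m)%N) (hl : (0 < l)%N)
    (hN : (0 < N)%N) (hM : (0 < M)%N)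
    (y : int -> 'cV[R]_p) (u : int -> 'cV[R]_m) (r : int -> 'cV[R]_M)
    (Q11 : 'M[R]_p) (Q12 : 'M[R]_(p, M)) (Q22 : 'M[R]_M)
    (hQ11 : Q11^T = Q11) (hQ22 : negdef Q22) :
  ((exists (L : 'M[R]_(m, zdim p m l)) (P : 'M[R]_(zdim p m l))
           (alpha beta : R),
      [/\ posdef P, 0 <= alpha, 0 < beta
        & lmi l Q11 Q12 Q22 N y u r L P alpha beta]) ->
    informative_quad_stab l Q11 Q12 Q22 N y u r) /\
  (forall (L : 'M[R]_(m, zdim p m l)) (P : 'M[R]_(zdim p m l)),
    posdef P ->
    (exists alpha beta : R,
      [/\ 0 <= alpha, 0 < beta
        & lmi l Q11 Q12 Q22 N y u r L P alpha beta]) ->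
    forall (A_z : 'M[R]_(zdim p m l)) (B_z : 'M[R]_(zdim p m l, m)),
      Sigma_bar l Q11 Q12 Q22 N y u r (A_z, B_z) ->
      stable (A_z + B_z *m (L *m invmx P))).
Proof.
split=> [[L [P [alpha [beta [Pp a0 b0 lmiP]]]]]|L P Pp [alpha [beta [a0 b0 lmiP]]] A B AB].
  exists (L *m invmx P), P; split=> // -[A B] AB.
  by apply: lmi_lyapunov lmiP AB.
apply: lyapunov_stable (Pp) _.
by apply: lmi_lyapunov lmiP AB.
Qed.
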